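(* Let $c>0$ and $\alpha>-\frac12$ be real numbers and let $n\ge0$ be an integer such that $\chi_{n,\alpha}(c)\ge 6\,\frac{\alpha+1}{\alpha+3}$ and $q=\frac{c^2}{\chi_{n,\alpha}(c)}$ satisfies $q\le\frac12+\alpha$ if $-\frac12<\alpha\le 0$, and $q\le\min\left(1,\frac12+\alpha\right)$ if $\alpha>0$. Then $$\sup_{t\in[-1,1]}|\varphi_{n,c}^{\alpha}(t)|=|\varphi_{n,c}^{\alpha}(1)|\le 3\sqrt{\alpha+1}\,\big(\chi_{n,\alpha}(c)\big)^{\frac{\alpha+1}{2}}.$$
   Context: $\omega_\alpha(t)=(1-t^2)^\alpha$. $\varphi_{n,c}^{\alpha}$ is the eigenfunction, normalized by $\int_{-1}^1(\varphi_{n,c}^\alpha)^2\omega_\alpha=1$, of the operator $\mathcal L_c^{\alpha}f(x)=\int_{-1}^1 e^{cxy}f(y)\omega_\alpha(y)\,dy$ on $L^2([-1,1],\omega_\alpha)$ associated with its $(n+1)$-th largest eigenvalue (eigenvalues indexed from $n=0$ in decreasing order). The functions $\varphi_{n,c}^\alpha$ are also the eigenfunctions of the Sturm–Liouville operator $-\mathcal D_c^\alpha$, and $\chi_{n,\alpha}(c)$ is the corresponding eigenvalue: $-\frac{d}{dx}\big[\omega_\alpha(x)(1-x^2)(\varphi_{n,c}^\alpha)'(x)\big]-c^2x^2\omega_\alpha(x)\varphi_{n,c}^\alpha(x)=\chi_{n,\alpha}(c)\,\omega_\alpha(x)\varphi_{n,c}^\alpha(x)$ for $x\in(-1,1)$;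 one has $n(n+2\alpha+1)-c^2\le\chi_{n,\alpha}(c)\le n(n+2\alpha+1)$. *)

(* Defs.v *)
From HB Require Import structures.
From mathcomp Require Import all_boot all_order all_algebra.
From mathcomp Require Import all_classical all_reals all_analysis.
Set Implicit Arguments. Unset Strict Implicit. Unset Printing Implicit Defensive.
Import Order.TTheory GRing.Theory Num.Theory.
Import numFieldNormedType.Exports.
Local Open Scope classical_set_scope.
Local Open Scope ring_scope.

Section PSWF.
Variable R : realType.
Notation mu := (@lebesgue_measure R).

Definition I11 : set R := `[(-1)%R, 1%R].

Definition omega (alpha t : R) : R := powR (1 - t ^+ 2) alpha.

Definition inL2w (alpha : R) (f : R -> R) : Prop :=
  measurable_fun I11 f /\
  mu.-integrable I11 (fun y => (f y ^+ 2 * omega alpha y)%:E).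

Definition Lop (c alpha : R) (f : R -> R) (x : R) : \bar R :=
  (\int[mu]_(y in I11) (expR (c * x * y) * f y * omega alpha y)%:E)%E.

Definition is_eigenvalue (c alpha lam : R) : Prop :=
  exists f : R -> R, inL2w alpha f /\
    (0 < \int[mu]_(y in I11) (f y ^+ 2 * omega alpha y)%:E)%E /\
    {ae mu, forall x, I11 x -> Lop c alpha f x = (lam * f x)%:E}.

(* lam is the (n+1)-th largest eigenvalue (exactly n eigenvalues exceed it) *)
Definition is_nth_eigenvalue (c alpha : R) (n : nat) (lam : R) : Prop :=
  is_eigenvalue c alpha lam /\
  exists s : seq R, uniq s /\ size s = n /\
    forall mu', mu' \in s <-> (is_eigenvalue c alpha mu' /\ lam < mu').

(* phi is the normalized eigenfunction phi_{n,c}^alpha (up to sign),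
   the eigen-equation holding at every point of [-1,1] *)
Definition is_pswf (c alpha : R) (n : nat) (phi : R -> R) : Prop :=
  inL2w alpha phi /\
  (\int[mu]_(y in I11) (phi y ^+ 2 * omega alpha y)%:E = 1)%E /\
  exists lam : R, is_nth_eigenvalue c alpha n lam /\
    forall x, -1 <= x <= 1 -> Lop c alpha phi x = (lam * phi x)%:E.

Definition is_SL_eigenvalue (c alpha : R) (phi : R -> R) (chi : R) : Prop :=
  forall x, -1 < x < 1 ->
    derivable phi x 1 /\
    derivable (fun t => omega alpha t * (1 - t ^+ 2) * derive1 phi t) x 1 /\
    - derive1 (fun t => omega alpha t * (1 - t ^+ 2) * derive1 phi t) x
      - c ^+ 2 * x ^+ 2 * omega alpha x * phi x
    = chi * omega alpha x * phi x.

End PSWF.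

(* Main.v *)
(* Since [Lop phi 0] is finite, [phi * omega] is integrable; its Laplace
   transform is Lipschitz and injective, so the eigenvalue is nonzero and [phi] is Lipschitz on
   [-1, 1], i.e. it is the solution of the Sturm-Liouville equation regular at both ends.
   The Sonin function [phi^2 + (1 - x^2) phi'^2 / (chi + c^2 x^2)] is nondecreasing on
   [0, 1), which bounds [phi^2] by [phi(1)^2] there; it also shows that a regular solution
   vanishing at [1] is zero, which applied to [phi(1) phi(-x) - phi(-1) phi(x)] gives
   [|phi(-1)| = |phi(1)|].
   Integrating the equation from [1] bounds [phi'] near [1] by a multiple of
   [chi * |phi(1)|], so [|phi|] stays above a fixed fraction of [|phi(1)|] for
   [1 - x^2 <= 1 / chi] (or [1 / (2 chi)] if [alpha <= 0]); the weighted mass of that region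
   must be at most the total mass [1]. *)

Require Import Defs.
From HB Require Import structures.
From mathcomp Require Import all_boot all_order all_algebra.
From mathcomp Require Import all_classical all_reals all_analysis.
From mathcomp Require Import measurable_realfun ring lra.
Import Order.TTheory GRing.Theory Num.Theory.
Import numFieldNormedType.Exports.
Local Open Scope classical_set_scope.
Local Open Scope ring_scope.

(** * Derivative rules, monotonicity and passage to the limit at [1] *)

Lemma scaleRE (R : realType) (a b : R) : a *: (b : R^o) = a * b.
Proof. by []. Qed.

Section Derivatives.
Context {R : realType}.
Implicit Types (f g : R -> R) (x y a b : R).

Lemma is_derive_mul f g x a b : is_derive x 1 f a -> is_derive x 1 g b ->
  is_derive x 1 (fun t => f t * g t) (a * g x + f x * b).
Proof.
move=> fa gb; have -> : (fun t => f t * g t) = f * g by [].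
by apply: is_derive_eq; rewrite !scaleRE; ring.
Qed.

Lemma is_derive_opp f x a : is_derive x 1 f a -> is_derive x 1 (fun t => - f t) (- a).
Proof. by move=> fa; apply: is_deriveN. Qed.

Lemma is_derive_add f g x a b : is_derive x 1 f a -> is_derive x 1 g b ->
  is_derive x 1 (fun t => f t + g t) (a + b).
Proof. by move=> fa gb; apply: is_deriveD. Qed.

Lemma is_derive_scale (k : R) f x a : is_derive x 1 f a ->
  is_derive x 1 (fun t => k * f t) (k * a).
Proof. by move=> fa; apply: is_deriveZ. Qed.

Lemma is_derive_expr f n x a : is_derive x 1 f a ->
  is_derive x 1 (fun t => f t ^+ n) (n%:R * f x ^+ n.-1 * a).
Proof.
move=> fa; have -> : (fun t => f t ^+ n) = f ^+ n.
  by apply/funext => t; rewrite -[RHS]/((f ^+ n) t) exprfctE.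
by apply: is_derive_eq; rewrite scaleRE.
Qed.

Lemma is_derive_inv f x a : f x != 0 -> is_derive x 1 f a ->
  is_derive x 1 (fun t => (f t)^-1) (- a / f x ^+ 2).
Proof.
move=> fx0 fa; apply: (is_derive_eq (is_deriveV fx0 fa)).
by rewrite scaleRE; field.
Qed.

Lemma is_derive_quadratic (u v x : R) : is_derive x 1 (fun t => u + v * t ^+ 2) (2 * v * x).
Proof.
have h1 := is_derive_scale v _ _ _ (is_derive_expr _ 2 _ _ (is_derive_id x 1)).
refine (is_derive_eq (is_derive_add _ _ _ _ _ (is_derive_cst u x 1) h1) _).
by rewrite /=; ring.
Qed.

Lemma is_derive_1Bsqr x : is_derive x 1 (fun t : R => 1 - t ^+ 2) (- 2 * x).
Proof.
have -> : (fun t : R => 1 - t ^+ 2) = (fun t => 1 + (-1) * t ^+ 2).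
  by apply/funext => t; rewrite mulN1r.
by refine (is_derive_eq (is_derive_quadratic _ _ _) _); ring.
Qed.

Lemma is_derive_omega (alpha x : R) : -1 < x < 1 ->
  is_derive x 1 (omega alpha) (- 2 * x * alpha * omega (alpha - 1) x).
Proof.
move=> /andP[x1 x2].
have x0 : 0 < 1 - x ^+ 2 by nra.
refine (is_derive_eq (is_derive1_comp (g := fun t => 1 - t ^+ 2)
  (is_derive1_powR alpha x0) (is_derive_1Bsqr x)) _).
by rewrite /omega; ring.
Qed.

Lemma is_derive_continuous f x a : is_derive x 1 f a -> {for x, continuous f}.
Proof. by move=> [d _]; apply/differentiable_continuous/derivable1_diffP. Qed.

Lemma is_derive_reflect f x a : is_derive (- x) 1 f a ->
  is_derive x 1 (fun t => f (- t)) (- a).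
Proof.
move=> fa.
refine (is_derive_eq (is_derive1_comp (g := -%R) fa (is_deriveNid x 1)) _).
by rewrite mulrN1.
Qed.

Lemma nondecreasing_is_derive f df x y : x <= y ->
  (forall t, x <= t <= y -> is_derive t 1 f (df t)) ->
  (forall t, x <= t <= y -> 0 <= df t) -> f x <= f y.
Proof.
move=> xy fd df0.
have [t||t txy E] := @MVT_segment R f df x y xy.
- by rewrite in_itv/= => /andP[? ?]; apply: fd; rewrite !ltW.
- by apply: continuous_in_subspaceT => t; rewrite inE/= in_itv/= => /fd /is_derive_continuous.
- by rewrite -subr_ge0 E mulr_ge0// ?subr_ge0// df0//; rewrite in_itv/= in txy.
Qed.

(** The error term vanishes as [y] tends to [1]. This replaces limits for functions that are
    Lipschitz up to the endpoint. *)
Lemma le_of_le_add_scale a b (C x0 : R) : x0 < 1 ->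
  (forall y, x0 <= y < 1 -> a <= b + C * (1 - y)) -> a <= b.
Proof.
move=> x01 H; apply/ler_addgt0Pr => e e0.
have C0 : 0 < `|C| + 1 by rewrite ltr_wpDl.
pose d := Num.min (1 - x0) (e / (`|C| + 1)).
have d0 : 0 < d by rewrite lt_min subr_gt0 x01 divr_gt0.
have dle : d <= 1 - x0 by rewrite ge_min lexx.
have dle2 : (`|C| + 1) * d <= e.
  by rewrite mulrC -ler_pdivlMr// ge_min lexx orbT.
have /H : x0 <= 1 - d < 1 by apply/andP; split; lra.
have := ler_norm C; nra.
Qed.

End Derivatives.

(** * The Sturm-Liouville equation in normal form and its Sonin function *)

Section ODE.
Context {R : realType} (c alpha chi : R).
Hypotheses (alpha_gt : - (1 / 2) < alpha) (chi_gt0 : 0 < chi).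
Implicit Types (f g : R -> R) (x y L : R).

Let alpha2_ge0 : 0 <= 2 * alpha + 1.
Proof. by have h := alpha_gt; lra. Qed.

(** The Sturm-Liouville equation as a first-order system, [g] standing for the derivative of [f].
    Dividing by [omega alpha x * (1 - x ^+ 2)] removes the weight and leaves a form that is visibly
    linear and stable under reflection. *)
Definition ode_solution (f g : R -> R) := forall x, -1 < x < 1 ->
  is_derive x 1 f (g x) /\
  is_derive x 1 g
    ((2 * (alpha + 1) * x * g x - (chi + c ^+ 2 * x ^+ 2) * f x) / (1 - x ^+ 2)).

Definition lipschitz11 (L : R) f :=
  forall x y, -1 <= x <= 1 -> -1 <= y <= 1 -> `|f x - f y| <= L * `|x - y|.

Lemma ode_solution_reflect f g : ode_solution f g ->
  ode_solution (fun t => f (- t)) (fun t => - g (- t)).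
Proof.
move=> sol x x11; have [|f' g'] := sol (- x); first by apply/andP; split; lra.
split; first exact: is_derive_reflect.
refine (is_derive_eq (is_derive_opp _ _ _ (is_derive_reflect _ _ _ g')) _).
by rewrite opprK sqrrN; congr (_ / _); ring.
Qed.

Lemma ode_solution_lin f1 g1 f2 g2 (a b : R) :
  ode_solution f1 g1 -> ode_solution f2 g2 ->
  ode_solution (fun t => a * f1 t + b * f2 t) (fun t => a * g1 t + b * g2 t).
Proof.
move=> s1 s2 x x11; have [f1' g1'] := s1 x x11; have [f2' g2'] := s2 x x11.
split; first by apply: is_derive_add; exact: is_derive_scale.
refine (is_derive_eq (is_derive_add _ _ _ _ _ (is_derive_scale _ _ _ _ g1')
  (is_derive_scale _ _ _ _ g2')) _).
by field; apply/negP => /eqP; case/andP: x11 => *; nra.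
Qed.

Lemma lipschitz11_reflect L f : lipschitz11 L f -> lipschitz11 L (fun t => f (- t)).
Proof.
move=> fL x y x1 y1; have -> : x - y = - (- x - - y) by ring.
rewrite normrN.
by apply: fL; apply/andP; split; lra.
Qed.

Lemma lipschitz11_lin L1 L2 f1 f2 (a b : R) : lipschitz11 L1 f1 -> lipschitz11 L2 f2 ->
  lipschitz11 (`|a| * L1 + `|b| * L2) (fun t => a * f1 t + b * f2 t).
Proof.
move=> l1 l2 x y x1 y1.
have -> : a * f1 x + b * f2 x - (a * f1 y + b * f2 y) =
  a * (f1 x - f1 y) + b * (f2 x - f2 y) by ring.
rewrite (le_trans (ler_normD _ _))// !normrM mulrDl -!mulrA.
by apply: lerD; apply: ler_wpM2l => //; [exact: l1|exact: l2].
Qed.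

Lemma lipschitz11_derive_le (L : R) f g x : 0 <= L -> lipschitz11 L f -> -1 < x < 1 ->
  is_derive x 1 f (g x) -> `|g x| <= L.
Proof.
move=> L0 fL /andP[x1 x2] fg.
have [_ <-] := fg.
have d : derivable f x 1 by case: fg.
have cv : h^-1 *: ((f \o shift x) (h *: 1) - f x) @[h --> 0^'] --> 'D_1 f x := d.
have cvn := cvg_norm cv.
refine (cvgr_to_le (cvn _) _).
have e0 : 0 < Num.min (1 - x) (x + 1) by rewrite lt_min; apply/andP; split; lra.
have : \forall h \near (0 : R), `|h| < Num.min (1 - x) (x + 1).
  by apply/nbhs0_lt.
move=> /nbhs_dnbhs; apply: filter_app; near=> h.
rewrite lt_min => /andP[h1 h2].
have h0 : h != 0 by near: h; exact: nbhs_dnbhs_neq.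
rewrite /= !scaleRE mulr1 normrM normfV mulrC ler_pdivrMr ?normr_gt0//.
have -> : L * `|h| = L * `|h + x - x| by rewrite addrK.
apply: fL; last by apply/andP; split; lra.
by move: h1 h2; rewrite !ltr_norml => /andP[? ?] /andP[? ?]; apply/andP; split; lra.
Unshelve. all: by end_near.
Qed.

Definition energy f g x := f x ^+ 2 + (1 - x ^+ 2) * g x ^+ 2 / (chi + c ^+ 2 * x ^+ 2).

Lemma weight_gt0 x : 0 < chi + c ^+ 2 * x ^+ 2.
Proof. by rewrite ltr_wpDr// mulr_ge0 ?sqr_ge0. Qed.

(** The denominator [chi + c ^+ 2 * x ^+ 2] is the coefficient of [f] in the equation, so the cross
    terms [2 * f * g] cancel and only a multiple of [g x ^+ 2] remains. *)
Lemma is_derive_energy f g x : ode_solution f g -> -1 < x < 1 ->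
  is_derive x 1 (energy f g)
    (2 * x * g x ^+ 2 * ((2 * alpha + 1) * (chi + c ^+ 2 * x ^+ 2) - c ^+ 2 * (1 - x ^+ 2))
     / (chi + c ^+ 2 * x ^+ 2) ^+ 2).
Proof.
move=> sol x11; have [f' g'] := sol x x11.
have w0 := weight_gt0 x.
have w1 : chi + c ^+ 2 * x ^+ 2 != 0 by rewrite gt_eqF.
refine (is_derive_eq (is_derive_add _ _ _ _ _ (is_derive_expr _ 2 _ _ f')
  (is_derive_mul _ _ _ _ _ (is_derive_mul _ _ _ _ _ (is_derive_1Bsqr x)
      (is_derive_expr _ 2 _ _ g'))
    (is_derive_inv (fun t => chi + c ^+ 2 * t ^+ 2) _ _ w1
      (is_derive_quadratic chi (c ^+ 2) x)))) _).
have p0 : 1 - x ^+ 2 != 0 by rewrite gt_eqF//; case/andP: x11 => *; nra.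
by rewrite /=; field; rewrite exprMn w1.
Qed.

Lemma sqr_le_energy f g x : -1 < x < 1 -> f x ^+ 2 <= energy f g x.
Proof.
move=> /andP[x1 x2]; rewrite lerDl divr_ge0 ?(ltW (weight_gt0 x))// mulr_ge0 ?sqr_ge0//.
nra.
Qed.

(* Uniqueness from [0]: [energy] can grow at most like an inverse
   power of [1 - x^2]. *)
Lemma ode_solution_eq0 f g x : ode_solution f g -> f 0 = 0 -> g 0 = 0 ->
  0 <= x < 1 -> f x = 0.
Proof.
have a0 := alpha2_ge0.
move=> sol f0 g0 /andP[x0 x1].
have [m hm] : exists m : nat, 2 * alpha + 1 <= m%:R.
  exists (Num.truncn (2 * alpha + 1)).+1; exact/ltW/truncnS_gt.
(* The derivative of [energy] is at most [2 * t * (2 * alpha + 1) / (1 - t ^+ 2)] times [energy], so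
   a high enough power of [1 - t ^+ 2] makes the product nonincreasing. [H] is its opposite;
   [H 0 = 0] then forces [energy f g x <= 0]. *)
pose H (t : R) := - (1 - t ^+ 2) ^+ m.+1 * energy f g t.
have H0 : H 0 <= H x.
  apply: (@nondecreasing_is_derive _ H (fun t => (1 - t ^+ 2) ^+ m * (2 * t *
    (m.+1%:R * energy f g t - (1 - t ^+ 2) * g t ^+ 2 * ((2 * alpha + 1) * (chi + c ^+ 2 * t ^+ 2) - c ^+ 2 * (1 - t ^+ 2))
     / (chi + c ^+ 2 * t ^+ 2) ^+ 2)))) => // t /andP[t0 tx].
    have t11 : -1 < t < 1 by apply/andP; split; lra.
    refine (is_derive_eq (is_derive_mul _ _ _ _ _ (is_derive_opp _ _ _
      (is_derive_expr _ m.+1 _ _ (is_derive_1Bsqr t))) (is_derive_energy _ _ _ sol t11)) _).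
    have w0 := weight_gt0 t.
    by rewrite /= (exprS _ m); field; rewrite exprMn gt_eqF.
  have t11 : -1 < t < 1 by apply/andP; split; lra.
  have w0 := weight_gt0 t.
  have p0 : 0 < 1 - t ^+ 2 by nra.
  apply: mulr_ge0; first by rewrite exprn_ge0 ?ltW.
  apply: mulr_ge0; first by rewrite mulr_ge0.
  rewrite subr_ge0.
  have E0 : 0 <= energy f g t by rewrite (le_trans _ (sqr_le_energy _ _ _ t11))// sqr_ge0.
  set v := (1 - t ^+ 2) * g t ^+ 2 / (chi + c ^+ 2 * t ^+ 2).
  have v0 : 0 <= v by rewrite divr_ge0 ?(ltW w0)// mulr_ge0 ?sqr_ge0// ltW.
  have vE : v <= energy f g t by rewrite lerDr sqr_ge0.
  apply: (@le_trans _ _ ((2 * alpha + 1) * v)); last first.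
    by apply: ler_pM => //; rewrite (le_trans hm)// ler_nat.
  rewrite /v in v0 *; move: w0 v0; set w := chi + _ => w0 v0.
  have -> : (1 - t ^+ 2) * g t ^+ 2 *
     ((2 * alpha + 1) * w - c ^+ 2 * (1 - t ^+ 2)) / w ^+ 2 =
     (2 * alpha + 1) * ((1 - t ^+ 2) * g t ^+ 2 / w)
     - c ^+ 2 * (1 - t ^+ 2) / w * ((1 - t ^+ 2) * g t ^+ 2 / w).
    by field; rewrite gt_eqF.
  rewrite gerBl; apply: mulr_ge0 => //; apply: divr_ge0; last exact: ltW.
  by rewrite mulr_ge0 ?sqr_ge0 ?ltW.
have x11 : -1 < x < 1 by apply/andP; split; lra.
move: H0; rewrite /H {1}/energy f0 g0 expr0n/= !mulr0 mul0r addr0 mulr0 mulNr oppr_ge0.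
have p0 : 0 < 1 - x ^+ 2 by nra.
rewrite pmulr_rle0 ?exprn_gt0// => E0.
by apply/eqP; rewrite -sqrf_eq0 eq_le sqr_ge0 andbT (le_trans _ E0)// sqr_le_energy.
Qed.

Hypothesis cq : c ^+ 2 <= (1 / 2 + alpha) * chi.

(** By [cq], [c ^+ 2] is at most half of [(2 * alpha + 1) * chi], which makes the bracket in the
    derivative of [energy] nonnegative. *)
Lemma energy_nondecreasing f g x y : ode_solution f g -> 0 <= x -> x <= y -> y < 1 ->
  energy f g x <= energy f g y.
Proof.
move=> sol x0 xy y1.
apply: (nondecreasing_is_derive _ _ _ _ xy) => [t /andP[xt ty]|t /andP[xt ty]].
  by apply: is_derive_energy => //; apply/andP; split; lra.
have w0 := weight_gt0 t.
apply: divr_ge0; rewrite ?sqr_ge0//; apply: mulr_ge0.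
  by apply: mulr_ge0; rewrite ?sqr_ge0//; lra.
have := chi_gt0; have := cq; have := alpha_gt.
have c0 := sqr_ge0 c; have ct0 : 0 <= c ^+ 2 * t ^+ 2 by rewrite mulr_ge0 ?sqr_ge0.
nra.
Qed.

(* The Lipschitz condition selects the solutions that are regular at [1]; for them
   the derivative term of [energy] vanishes at the endpoint. *)
Lemma energy_le_endpoint L f g x : 0 <= L -> lipschitz11 L f -> ode_solution f g ->
  0 <= x < 1 -> energy f g x <= f 1 ^+ 2.
Proof.
move=> L0 fL sol /andP[x0 x1].
(* The first summand bounds the growth of [f y ^+ 2 - f 1 ^+ 2], from [|f y - f 1| <= L * (1 - y)].
   The second bounds the derivative term, from [|g y| <= L] and [1 - y ^+ 2 <= 2 * (1 - y)]. *)
apply: (@le_of_le_add_scale _ _ _ (2 * L * (`|f 1| + L) + 2 * (L ^+ 2 / chi)) x) => // y /andP[xy y1].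
apply: (le_trans (@energy_nondecreasing f g x y sol x0 xy y1)).
have y11 : -1 < y < 1 by apply/andP; split; lra.
have gL : `|g y| <= L by apply: (@lipschitz11_derive_le L f) => //; case: (sol y y11).
have fy : `|f y - f 1| <= L * (1 - y).
  by rewrite distrC -[X in _ * X]ger0_norm; [apply: fL; apply/andP; split; lra|lra].
rewrite /energy (mulrDl _ _ (1 - y)) addrA; apply: lerD.
  have n1 := ler_norm (f 1); have n2 := ler_norm (- f 1); rewrite normrN in n2.
  move: fy; rewrite ler_norml => /andP[fy1 fy2].
  have {n1 n2} : - `|f 1| <= f 1 <= `|f 1| by apply/andP; split; lra.
  set M := `|f 1|; move=> /andP[n1 n2].
  set e := f y - f 1 in fy1 fy2.
  have -> : f y = f 1 + e by rewrite /e; ring.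
  have : e ^+ 2 <= 2 * L ^+ 2 * (1 - y).
    have : 0 <= L * (1 - y) by rewrite mulr_ge0//; lra.
    have : L * (1 - y) <= 2 * L by nra.
    set z := L * (1 - y) in fy1 fy2 *; move=> z1 z2.
    have -> : 2 * L ^+ 2 * (1 - y) = 2 * L * z by rewrite /z; ring.
    nra.
  have : f 1 * e <= M * (L * (1 - y)) by nra.
  nra.
have w0 := weight_gt0 y.
have chi0 := chi_gt0.
have cy : 0 <= c ^+ 2 * y ^+ 2 by rewrite mulr_ge0 ?sqr_ge0.
have gy2 : g y ^+ 2 <= L ^+ 2 by rewrite -(@real_normK _ (g y)) ?num_real// ler_pXn2r// nnegrE.
rewrite ler_pdivrMr// mulrAC.
have -> : 2 * (L ^+ 2 / chi) * (chi + c ^+ 2 * y ^+ 2) * (1 - y)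
  = (2 * (1 - y)) * (L ^+ 2 * ((chi + c ^+ 2 * y ^+ 2) / chi)) by field; rewrite gt_eqF.
apply: ler_pM; rewrite ?sqr_ge0//; [nra|nra|].
rewrite (le_trans gy2)// ler_peMr ?sqr_ge0// ler_pdivlMr//; lra.
Qed.

(** The endpoint bound makes [energy] vanish at [0], hence both Cauchy data there. Uniqueness from
    [0], applied to the reflected solution, carries the vanishing to the left half of the
    interval. *)
Lemma ode_solution_endpoint_eq0 L f g : 0 <= L -> lipschitz11 L f -> ode_solution f g ->
  f 1 = 0 -> f (-1) = 0.
Proof.
move=> L0 fL sol f1.
have E0 x : 0 <= x < 1 -> energy f g x <= 0.
  by move=> x01; have := energy_le_endpoint _ _ _ _ L0 fL sol x01; rewrite f1 expr0n.
have z : (0 : R) <= 0 < (1 : R) by rewrite lexx ltr01.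
have f0 : f 0 = 0.
  apply/eqP; rewrite -sqrf_eq0 eq_le sqr_ge0 andbT (le_trans _ (E0 0 z))//.
  by apply: sqr_le_energy; rewrite ltrN10 ltr01.
have g0 : g 0 = 0.
  have := E0 0 z; rewrite /energy f0 expr0n/= mulr0 addr0 add0r subr0 mul1r => e0.
  have {}e0 : g 0 ^+ 2 <= 0 by move: e0; rewrite pmulr_lle0// invr_gt0.
  by apply/eqP; rewrite -sqrf_eq0 eq_le e0 sqr_ge0.
have r x : 0 <= x < 1 -> f (- x) = 0.
  apply: (@ode_solution_eq0 (fun t => f (- t)) (fun t => - g (- t))).
  - exact: ode_solution_reflect.
  - by rewrite oppr0.
  - by rewrite oppr0 g0 oppr0.
(* The equation says nothing at [-1] itself; the value there is reached by the Lipschitz bound. *)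
apply/eqP; rewrite -normr_eq0 eq_le normr_ge0 andbT.
apply: (@le_of_le_add_scale _ _ _ L 0) => // y /andP[y0 y1].
have h1 : -1 <= (-1 : R) <= 1 by apply/andP; split; lra.
have h2 : -1 <= - y <= 1 by apply/andP; split; lra.
have := fL _ _ h1 h2; rewrite r ?y0// subr0 add0r.
have -> : -1 - - y = - (1 - y) by ring.
by rewrite normrN (@ger0_norm _ (1 - y)) ?subr_ge0// ltW.
Qed.

Lemma ode_solution_parity L f g : 0 <= L -> lipschitz11 L f -> ode_solution f g ->
  `|f (-1)| = `|f 1|.
Proof.
move=> L0 fL sol.
pose fr t := f (- t); pose gr t := - g (- t).
have solr : ode_solution fr gr by exact: ode_solution_reflect.
have := @ode_solution_endpoint_eq0 _ _ _ _
  (lipschitz11_lin _ _ _ _ (f 1) (- f (-1)) (lipschitz11_reflect _ _ fL) fL)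
  (ode_solution_lin _ _ _ _ (f 1) (- f (-1)) solr sol).
rewrite /fr opprK => H.
(* This is the value at [-1] of the combination [f 1 * f (- t) - f (-1) * f t], which vanishes at
   [1]. *)
have : f 1 * f 1 + - f (-1) * f (-1) = 0.
  apply: H; first by rewrite addr_ge0// mulr_ge0.
  by ring.
by move=> /eqP; rewrite mulNr subr_eq0 -!expr2 eqf_sqr => /orP[] /eqP ->; rewrite ?normrN.
Qed.

Lemma ode_solution_le_endpoint L f g x : 0 <= L -> lipschitz11 L f -> ode_solution f g ->
  -1 <= x <= 1 -> `|f x| <= `|f 1|.
Proof.
move=> L0 fL sol.
have pos h k y : lipschitz11 L h -> ode_solution h k -> 0 <= y <= 1 -> `|h y| <= `|h 1|.
  move=> hL hs /andP[y0]; rewrite le_eqVlt => /predU1P[->//|y1].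
  rewrite -(@ler_pXn2r _ 2%N)// ?nnegrE// -!normrX !ger0_norm ?sqr_ge0//.
  apply: (le_trans (@sqr_le_energy h k y _)); first by apply/andP; split; lra.
  by apply: (energy_le_endpoint L) => //; rewrite y0.
move=> /andP[x1 x2]; have [x0|x0] := leP 0 x; first by apply: (pos f g) => //; rewrite x0.
rewrite -(ode_solution_parity L f g)// -[x]opprK.
apply: (pos (fun t => f (- t)) (fun t => - g (- t)) (- x)).
- exact: lipschitz11_reflect.
- exact: ode_solution_reflect.
- by apply/andP; split; lra.
Qed.

End ODE.

(** * The Jacobi weight: derivative, decay at the endpoint, explicit integral *)

Section Omega.
Context {R : realType}.
Implicit Types (alpha x y : R).

Lemma omega_gt0 alpha x : -1 < x < 1 -> 0 < omega alpha x.
Proof. by move=> /andP[x1 x2]; apply: powR_gt0; nra. Qed.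

Lemma omega_ge0 alpha x : 0 <= omega alpha x.
Proof. exact: powR_ge0. Qed.

Lemma omegaS alpha x : -1 < x < 1 -> omega (alpha + 1) x = omega alpha x * (1 - x ^+ 2).
Proof.
move=> /andP[x1 x2]; have x0 : 0 < 1 - x ^+ 2 by nra.
by rewrite /omega powRD ?powRr1 ?ltW// ?(gt_eqF x0) ?implybT.
Qed.

(** This identity makes [omega (alpha + 1)] both the integrating factor of the equation and, up to a
    constant, a primitive of [t * omega alpha t]. *)
Lemma is_derive_omegaS alpha x : -1 < x < 1 ->
  is_derive x 1 (omega (alpha + 1)) (- 2 * (alpha + 1) * x * omega alpha x).
Proof.
move=> x11; refine (is_derive_eq (is_derive_omega _ _ x11) _).
by rewrite addrK; ring.
Qed.

(** For [beta > 0] the weight tends to [0] at [1], so the bound passes to the limit. *)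
Lemma le0_of_le_scale_omega (h C beta x0 : R) : 0 < beta -> 0 <= x0 < 1 ->
  (forall y, x0 <= y < 1 -> h <= C * omega beta y) -> h <= 0.
Proof.
move=> b0 /andP[x00 x01] H; rewrite leNgt; apply/negP => h0.
have bN0 : beta != 0 by rewrite gt_eqF.
have C0 : 0 < `|C| + 1 by rewrite ltr_wpDl.
have e0 : 0 < h / (2 * (`|C| + 1)) by rewrite divr_gt0// mulr_gt0.
pose r := (h / (2 * (`|C| + 1))) `^ (beta^-1).
(* The test point is [y = Num.sqrt (1 - d)]: then [omega beta y] is the [beta]-th power of [d],
   small by the choice of [r], and the second argument of the minimum ensures [x0 <= y]. *)
pose d : R := Num.min r (1 - x0 ^+ 2).
have d0 : 0 < d by rewrite lt_min powR_gt0//=; nra.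
have dx : d <= 1 - x0 ^+ 2 by rewrite ge_min lexx orbT.
have dr : d `^ beta <= h / (2 * (`|C| + 1)).
  have -> : h / (2 * (`|C| + 1)) = r `^ beta.
    by rewrite /r -powRrM (mulVf bN0) powRr1// ltW.
  by apply: ge0_ler_powR; rewrite ?nnegrE ?powR_ge0 ?(ltW b0) ?(ltW d0)// ge_min lexx.
have y2 : (Num.sqrt (1 - d)) ^+ 2 = 1 - d by rewrite sqr_sqrtr//; nra.
have ys := sqrtr_ge0 (1 - d).
have := H (Num.sqrt (1 - d)); rewrite /omega y2 subKr => {}H.
have : h <= C * d `^ beta by apply: H; apply/andP; split; nra.
have p0 := powR_ge0 d beta.
have Cp : C * d `^ beta <= (`|C| + 1) * d `^ beta.
  by apply: ler_wpM2r => //; have := ler_norm C; lra.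
have : (`|C| + 1) * d `^ beta <= h / 2.
  rewrite (_ : h / 2 = (`|C| + 1) * (h / (2 * (`|C| + 1)))); last by field; rewrite gt_eqF.
  by rewrite ler_pM2l.
lra.
Qed.

Lemma integral_scale_id_omega (alpha k a b : R) : - 1 < alpha -> -1 < a -> a < b -> b < 1 ->
  (\int[lebesgue_measure]_(t in `[a, b]) (k * t * omega alpha t)%:E =
   (k / (2 * (alpha + 1)) * (omega (alpha + 1) a - omega (alpha + 1) b))%:E)%E.
Proof.
move=> a1 aa ab bb.
have a10 : alpha + 1 != 0 by rewrite gt_eqF//; lra.
pose F (t : R) : R := (- k / (2 * (alpha + 1))) * omega (alpha + 1) t.
have dF (t : R) : -1 < t < 1 -> is_derive t 1 F (k * t * omega alpha t).
  move=> t11; refine (is_derive_eq (is_derive_scale _ _ _ _ (is_derive_omegaS alpha t t11)) _).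
  by field.
have inab (t : R) : t \in `[a, b] -> -1 < t < 1.
  by rewrite in_itv/= => /andP[? ?]; apply/andP; split; lra.
rewrite (@continuous_FTC2 _ _ F) => //.
- by rewrite -EFinB /F; congr (_%:E); ring.
- apply: continuous_in_subspaceT => t; rewrite inE => /inab t11.
  have h := is_derive_mul _ _ _ _ _ (is_derive_scale k _ _ _ (is_derive_id t 1)) (is_derive_omega alpha t t11).
  exact: is_derive_continuous h.
- split.
  + move=> t; rewrite in_itv/= => /andP[t1 t2].
    by case: (dF t) => //; apply/andP; split; lra.
  + apply: cvg_at_right_filter; apply: (is_derive_continuous _ _ _ (dF a _)).
    by apply/andP; split; lra.
  + apply: cvg_at_left_filter; apply: (is_derive_continuous _ _ _ (dF b _)).
    by apply/andP; split; lra.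
- move=> t; rewrite in_itv/= => /andP[t1 t2].
  have t11 : -1 < t < 1 by apply/andP; split; lra.
  by rewrite derive1E; case: (dF t t11).
Qed.

End Omega.

(** * From the divergence form to the normal form, and estimates near [1] *)

Section SturmLiouville.
Context {R : realType}.
Implicit Types (c alpha chi x y L M : R) (f g phi : R -> R).

(** Near [x] the derivative of [phi] is the quotient of the flux [G] by [omega (alpha + 1)]. Both
    are differentiable, which gives the second derivative of [phi] as well as its value. *)
Lemma SL_ode_solution c alpha chi phi :
  is_SL_eigenvalue c alpha phi chi -> ode_solution c alpha chi phi (derive1 phi).
Proof.
move=> SL x x11; have [dphi [dG eqn]] := SL x x11.
split; first by rewrite derive1E; exact: derivableP.
have p0 : 1 - x ^+ 2 != 0 by rewrite gt_eqF//; case/andP: x11 => *; nra.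
have w0 : omega alpha x != 0 by rewrite gt_eqF// omega_gt0.
set G := fun t => omega alpha t * (1 - t ^+ 2) * derive1 phi t in dG eqn.
have G' : is_derive x 1 G (- (chi + c ^+ 2 * x ^+ 2) * omega alpha x * phi x).
  rewrite (_ : - _ * _ * _ = derive1 G x); first by rewrite derive1E; exact: derivableP.
  lra.
have W0 : omega (alpha + 1) x != 0 by rewrite gt_eqF// omega_gt0.
have h := is_derive_mul _ _ _ _ _ G'
  (is_derive_inv (omega (alpha + 1)) _ _ W0 (is_derive_omegaS _ _ x11)).
apply: (near_eq_is_derive _ (is_derive_eq h _)).
  have : \forall t \near x, t \in `]-1, 1[ by apply: near_in_itvoo; rewrite in_itv.
  apply: filterS => t; rewrite in_itv/= => t11.
  rewrite omegaS// /G; field.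
  by rewrite !gt_eqF ?omega_gt0//; case/andP: t11 => *; nra.
by rewrite omegaS// /G; field; rewrite p0.
Qed.

(** The function [H = omega (alpha + 1) * (g - B)] is nondecreasing on [[x0, 1)]: its derivative is
    [omega alpha t * (2 * (alpha + 1) * t * B - (chi + c ^+ 2 * t ^+ 2) * f t)], and [B] is the
    constant that makes this nonnegative from [t = x0] on. Since [g] is bounded, [H] is at most a
    quantity tending to [0] at [1], so [H <= 0]. *)
Lemma ode_solution_derive_le c alpha chi L M f g x0 x :
  - 1 < alpha -> 0 < chi -> 0 <= L -> lipschitz11 L f -> ode_solution c alpha chi f g ->
  (forall t, -1 <= t <= 1 -> `|f t| <= M) -> 0 < x0 -> x0 <= x < 1 ->
  g x <= (chi + c ^+ 2) * M / (2 * (alpha + 1) * x0).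
Proof.
move=> a1 chi0 L0 fL sol fM x00 /andP[x0x x1].
set B := _ / _.
have M0 : 0 <= M by rewrite (le_trans (normr_ge0 (f 0)))// fM// lerN10 ler01.
have B0 : 0 <= B.
  apply: divr_ge0; first by rewrite mulr_ge0// addr_ge0 ?sqr_ge0 ?ltW.
  by rewrite !mulr_ge0//; lra.
pose H t := omega (alpha + 1) t * (g t - B).
have a10 : 0 < alpha + 1 by lra.
have Hle y : x <= y < 1 -> H x <= H y.
  move=> /andP[xy y1].
  apply: (nondecreasing_is_derive H (fun t => omega alpha t *
    (2 * (alpha + 1) * t * B - (chi + c ^+ 2 * t ^+ 2) * f t)) _ _ xy) => t /andP[xt ty].
    have t11 : -1 < t < 1 by apply/andP; split; lra.
    have [_ g'] := sol t t11.
    refine (is_derive_eq (is_derive_mul _ _ _ _ _ (is_derive_omegaS alpha t t11)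
      (is_derive_add _ _ _ _ _ g' (is_derive_cst (- B) t 1))) _).
    rewrite omegaS//= /cst; move: (B) => b; field.
    by rewrite gt_eqF//; case/andP: t11 => *; nra.
  apply: mulr_ge0; first exact: omega_ge0.
  rewrite subr_ge0.
  apply: (@le_trans _ _ ((chi + c ^+ 2) * M)).
    have [f0|f0] := leP (f t) 0.
      apply: (@le_trans _ _ 0); last by rewrite mulr_ge0// addr_ge0 ?sqr_ge0 ?ltW.
      by rewrite mulr_ge0_le0// ltW// weight_gt0.
    apply: ler_pM; rewrite ?(ltW f0) ?(ltW (weight_gt0 _ _ chi0 _))//.
      by rewrite lerD2l ler_piMr ?sqr_ge0//; nra.
    by rewrite (le_trans (ler_norm _))// fM//; apply/andP; split; lra.
  rewrite (_ : (chi + c ^+ 2) * M = 2 * (alpha + 1) * x0 * B); last first.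
    by rewrite /B; field; rewrite !gt_eqF.
  by rewrite ler_wpM2r// ler_wpM2l//; lra.
rewrite -subr_le0 -(pmulr_rle0 _ (_ : 0 < omega (alpha + 1) x)); last first.
  by apply: omega_gt0; apply/andP; split; lra.
apply: (@le0_of_le_scale_omega R _ L (alpha + 1) x) => //; first by apply/andP; split; lra.
move=> y /andP[xy y1]; apply: (le_trans (Hle y _)); first by rewrite xy.
rewrite /H [leLHS]mulrC ler_wpM2r ?omega_ge0//.
have y11 : -1 < y < 1 by apply/andP; split; lra.
have : `|g y| <= L by apply: (lipschitz11_derive_le L f) => //; case: (sol y y11).
by have := ler_norm (g y); lra.
Qed.

(** When [f 1 >= 0], the upper bound [B] on [g] makes [B * t - f t] nondecreasing, so [f] loses at
    most [B * (1 - x0)] going back from [1]. *)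
Lemma ode_solution_ge_near_endpoint c alpha chi L M f g x0 x :
  - 1 < alpha -> 0 < chi -> 0 <= L -> lipschitz11 L f -> ode_solution c alpha chi f g ->
  (forall t, -1 <= t <= 1 -> `|f t| <= M) -> 0 < x0 -> x0 <= x < 1 ->
  `|f 1| - (chi + c ^+ 2) * M / (2 * (alpha + 1) * x0) * (1 - x0) <= `|f x|.
Proof.
move=> a1 chi0 L0 fL sol fM x00 /andP[x0x x1].
wlog f10 : f g fL sol fM / 0 <= f 1.
  move=> W; have [|f1] := leP 0 (f 1); first exact: (W f g).
  (* The opposite solution, written as a linear combination so that [ode_solution_lin] applies. *)
  have := W (fun t => (-1) * f t + 0 * f t) (fun t => (-1) * g t + 0 * g t).
  rewrite !mul0r !addr0 !mulN1r !normrN; apply.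
  - move=> s t hs ht; rewrite !mul0r !addr0 !mulN1r.
    have -> : - f s - - f t = - (f s - f t) by ring.
    by rewrite normrN; exact: fL.
  - exact: ode_solution_lin.
  - by move=> t ht; rewrite mul0r addr0 mulN1r normrN fM.
  - lra.
set B := (_ * M / _).
have gB t : x0 <= t < 1 -> g t <= B by move=> ht; apply: (ode_solution_derive_le c alpha chi L M f).
have B0 : 0 <= B * (1 - x0).
  have M0 : 0 <= M by rewrite (le_trans (normr_ge0 (f 0)))// fM// lerN10 ler01.
  apply: mulr_ge0; last lra.
  apply: divr_ge0; first by rewrite mulr_ge0// addr_ge0 ?sqr_ge0 ?ltW.
  by rewrite !mulr_ge0//; lra.
rewrite ger0_norm// (le_trans _ (ler_norm _))// lerBlDr.
apply: (le_of_le_add_scale _ _ L x) => // y /andP[xy y1].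
have y11 : -1 <= y <= 1 by apply/andP; split; lra.
have o11 : -1 <= (1 : R) <= 1 by apply/andP; split; lra.
have := fL _ _ o11 y11; rewrite (@ger0_norm _ (1 - y)); last lra.
move=> /(le_trans (ler_norm _)) f1y.
have : B * x - f x <= B * y - f y.
  apply: (nondecreasing_is_derive (fun t => B * t - f t) (fun t => B * 1 - g t) _ _ xy) => t /andP[xt ty].
    have t11 : -1 < t < 1 by apply/andP; split; lra.
    have [f' _] := sol t t11.
    exact: (is_derive_add _ _ _ _ _ (is_derive_scale B _ _ _ (is_derive_id t 1))
      (is_derive_opp _ _ _ f')).
  by rewrite mulr1 subr_ge0 gB//; apply/andP; split; lra.
have B1 : 0 <= B by move: B0; rewrite pmulr_lge0//; lra.
have : B * (y - x) <= B * (1 - x0) by apply: ler_wpM2l => //; lra.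
lra.
Qed.

End SturmLiouville.

(** * Two-sided Lipschitz bounds for the exponential *)

Section Exponential.
Context {R : realType}.
Implicit Types (u v K : R).

Lemma expRB_le u v : expR u - expR v <= expR u * (u - v).
Proof.
have -> : expR u - expR v = expR u * (1 - expR (v - u)).
  by rewrite mulrBr mulr1 -expRD; congr (_ - expR _); ring.
by rewrite ler_wpM2l ?expR_ge0//; have := expR_ge1Dx (v - u); lra.
Qed.

Lemma norm_expRB_bounds K u v : `|u| <= K -> `|v| <= K ->
  expR (- K) * `|u - v| <= `|expR u - expR v| <= expR K * `|u - v|.
Proof.
wlog vu : u v / v <= u.
  move=> W uK vK; have [/W|/ltW /W] := leP v u; first exact.
  by rewrite distrC [`|expR v - _|]distrC; exact.
move=> uK vK; have := uK; have := vK; rewrite ler_norml => /andP[v1 v2].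
rewrite ler_norml => /andP[u1 u2].
have uv0 : 0 <= u - v by lra.
have e0 : 0 <= expR u - expR v by rewrite subr_ge0 ler_expR.
rewrite (ger0_norm uv0) (ger0_norm e0); apply/andP; split; last first.
  by apply: (le_trans (expRB_le u v)); rewrite ler_wpM2r// ler_expR.
have := expRB_le v u.
have : expR (- K) * (u - v) <= expR v * (u - v) by rewrite ler_wpM2r// ler_expR.
lra.
Qed.

End Exponential.

(** * The finite Laplace transform on [[-1, 1]] *)

Section Laplace.
Context {R : realType}.
Notation mu := (@lebesgue_measure R).
Implicit Types (c : R) (f k : R -> R).

Lemma measurable_I11 : measurable (@I11 R).
Proof. exact: measurable_itv. Qed.
Hint Resolve measurable_I11 : core.

Local Notation integrable11 f := (mu.-integrable (@I11 R) (EFin \o f)).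

Lemma integrable11D f g : integrable11 f -> integrable11 g ->
  integrable11 (fun y => f y + g y).
Proof. by move=> ? ?; exact: (@integrableD _ _ _ mu _ measurable_I11 (EFin \o f) (EFin \o g)). Qed.

Lemma integrable11B f g : integrable11 f -> integrable11 g ->
  integrable11 (fun y => f y - g y).
Proof. by move=> ? ?; exact: (@integrableB _ _ _ mu _ measurable_I11 (EFin \o f) (EFin \o g)). Qed.

Lemma integrable11Z (a : R) f : integrable11 f -> integrable11 (fun y => a * f y).
Proof. by move=> ?; exact: (@integrableZl _ _ _ mu _ measurable_I11 a (EFin \o f)). Qed.

Lemma measurable_omega (D : set R) (alpha : R) : measurable_fun D (omega alpha).
Proof.
apply: measurable_funTS.
apply: (measurableT_comp (measurable_powR alpha)).
by apply: measurable_funB => //; exact: exprn_measurable.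
Qed.

Lemma integrable_expR_mul (a : R) f : integrable11 f ->
  integrable11 (fun y => expR (a * y) * f y).
Proof.
move=> intf.
apply: (@integrableMr _ _ _ mu (@I11 R) measurable_I11 (fun y => expR (a * y)) (EFin \o f)) => //.
  by apply: measurable_funTS; apply: measurableT_comp => //; exact: mulrl_measurable.
exists (expR `|a|); split; first exact: num_real.
move=> M aM y; rewrite /I11/= in_itv/= => y1.
rewrite ger0_norm ?expR_ge0// (le_trans _ (ltW aM))// ler_expR.
by rewrite (le_trans (ler_norm _))// normrM ler_piMr// ler_norml.
Qed.

(** The weight is absorbed into [f], and the integral is real-valued: it agrees with [Lop] through
    [fine]. *)
Definition laplace c f x : R := \int[mu]_(y in @I11 R) (expR (c * x * y) * f y).

Lemma laplace_lipschitz c f : 0 <= c -> integrable11 f ->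
  lipschitz11 (expR c * c * \int[mu]_(y in @I11 R) `|f y|) (laplace c f).
Proof.
move=> c0 intf x x' x1 x'1.
have intn : integrable11 (fun y => `|f y|) by exact: integrable_norm.
have ie t : integrable11 (fun y => expR (c * t * y) * f y).
  exact: integrable_expR_mul.
rewrite /laplace -RintegralB//.
have iB := integrable11B _ _ (ie x) (ie x').
apply: (le_trans (le_normr_Rintegral _ iB)) => //.
rewrite mulrAC -RintegralZl//.
apply: le_Rintegral => //.
- exact: integrable_norm iB.
- exact: integrable11Z.
- move=> y; rewrite /I11/= in_itv/= => y1.
  rewrite -mulrBl normrM ler_wpM2r//.
  have bd t : -1 <= t <= 1 -> `|c * t * y| <= c.
    move=> t1; rewrite !normrM (ger0_norm c0) -mulrA ler_piMr//.
    by rewrite mulr_ile1// ler_norml.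
  have /andP[_ h] := norm_expRB_bounds _ _ _ (bd x x1) (bd x' x'1).
  apply: (le_trans h); rewrite -[leRHS]mulrA ler_wpM2l ?expR_ge0//.
  have -> : c * x * y - c * x' * y = c * ((x - x') * y) by ring.
  by rewrite !normrM (ger0_norm c0) ler_wpM2l// ler_piMr// ler_norml.
Qed.

(** The monomial of degree [i <= N] integrates to the transform at [i / N], a point of [[0, 1]]. *)
Lemma Rintegral_poly_expR c f (p : {poly R}) (N : nat) : (size p <= N.+1)%N -> (0 < N)%N ->
  integrable11 f ->
  (forall x, 0 <= x <= 1 -> laplace c f x = 0) ->
  integrable11 (fun y => p.[expR (c / N%:R * y)] * f y) /\
  \int[mu]_(y in @I11 R) (p.[expR (c / N%:R * y)] * f y) = 0.
Proof.
move=> sp N0 intf lap0.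
have NN : N%:R != 0 :> R by rewrite pnatr_eq0 -lt0n.
have ie (i : nat) : integrable11 (fun y => expR (c / N%:R * y) ^+ i * f y).
  have -> : (fun y => expR (c / N%:R * y) ^+ i * f y) =
      (fun y => expR (i%:R * (c / N%:R) * y) * f y).
    by apply/funext => y; rewrite -expRM_natl mulrA.
  exact: integrable_expR_mul.
have z (i : nat) : (i <= N)%N -> \int[mu]_(y in @I11 R) (expR (c / N%:R * y) ^+ i * f y) = 0.
  move=> iN; rewrite -(lap0 (i%:R / N%:R)).
    apply: eq_Rintegral => y _; congr (_ * _).
    by rewrite -expRM_natl; congr expR; field.
  by rewrite divr_ge0//= ler_pdivrMr ?ltr0n// mul1r ler_nat.
pose S n y := \sum_(i < n) (p`_i * (expR (c / N%:R * y) ^+ i * f y)).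
have <- : S N.+1 = (fun y => p.[expR (c / N%:R * y)] * f y).
  apply/funext => y; rewrite (horner_coef_wide _ sp) big_distrl/=.
  by apply: eq_bigr => i _; rewrite mulrA.
suff : forall n, (n <= N.+1)%N -> integrable11 (S n) /\
    \int[mu]_(y in @I11 R) S n y = 0 by apply.
elim=> [_|n IH nN].
  have -> : S 0%N = cst 0 by apply/funext => y; rewrite /S big_ord0.
  by split; [exact: integrable0|rewrite Rintegral_cst// mul0r].
have [iS S0] := IH (ltnW nN).
have -> : S n.+1 = (fun y => S n y + p`_n * (expR (c / N%:R * y) ^+ n * f y)).
  by apply/funext => y; rewrite /S big_ord_recr.
have it := integrable11Z p`_n _ (ie n).
split; first exact: integrable11D.
by rewrite RintegralD// S0 RintegralZl// z// mulr0 addr0.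
Qed.

End Laplace.

(** * Injectivity of the transform and regularity of the eigenfunctions *)

Section Injectivity.
Context {R : realType}.
Notation mu := (@lebesgue_measure R).
Local Notation integrable11 f := (mu.-integrable (@I11 R) (EFin \o f)).
Implicit Types (c : R) (f : R -> R).
#[local] Hint Resolve measurable_I11 : core.

Lemma bernoulli_expr (x : R) n : 0 <= x -> 1 + n%:R * x <= (1 + x) ^+ n.
Proof.
move=> x0; elim: n => [|n IH]; first by rewrite mul0r addr0 expr0.
rewrite exprS (le_trans _ (ler_wpM2l _ IH))//; last by rewrite addr_ge0.
have n0 : 0 <= n%:R * x by rewrite mulr_ge0.
by rewrite -natr1; nra.
Qed.

(** The integral is the difference of those of the positive and negative parts, and the conventional
    value of infinity minus infinity is not finite. A finite value thus forces both parts to be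
    finite. *)
Lemma integrable_of_fin_num (D : set R) (g : R -> \bar R) : measurable D ->
  measurable_fun D g -> (\int[mu]_(y in D) g y)%E \is a fin_num -> mu.-integrable D g.
Proof.
move=> mD mg; rewrite integralE.
have p0 : (0 <= \int[mu]_(y in D) (g ^\+ y))%E by exact: integral_ge0.
have n0 : (0 <= \int[mu]_(y in D) (g ^\- y))%E by exact: integral_ge0.
move=> fin; apply/integrableP; split => //.
have -> : (\int[mu]_(y in D) `|g y|)%E =
    (\int[mu]_(y in D) (g ^\+ y) + \int[mu]_(y in D) (g ^\- y))%E.
  rewrite -ge0_integralD//; last 2 first.
  - exact: measurable_funepos.
  - exact: measurable_funeneg.
  by apply: eq_integral => y _; rewrite -[LHS]/((abse \o g) y) fune_abse.
move: p0 n0 fin; case: (\int[mu]_(y in D) (g ^\+ y))%E => [r| |]//;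
  case: (\int[mu]_(y in D) (g ^\- y))%E => [s| |]// _ _ _.
by rewrite -EFinD ltry.
Qed.

(* The powers of [1 + eta - w], [w] close to a multiple of [(y - x0) ^ 2], concentrate
   at [x0]. To be annihilated by [f], they must be polynomials in [expR (c * y / (2 * N))]
   of degree at most [2 * N]: this dictates the choice of [w]. *)
Lemma laplace_eq0_bump c f (x0 delta m : R) : 0 < c -> integrable11 f ->
  (forall x, 0 <= x <= 1 -> laplace c f x = 0) ->
  0 < delta -> -1 <= x0 - delta -> x0 + delta <= 1 -> 0 < m ->
  ~ (forall y, `|y - x0| <= delta -> m <= f y).
Proof.
move=> c0 intf lap0 d0 x0l x0r m0 fm.
have E0 : 0 < expR (- c) by exact: expR_gt0.
have E1 : expR (- c) <= 1 by rewrite -expR0 ler_expR oppr_le0 ltW.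
have EC : expR c * expR (- c) = 1 by rewrite -expRD subrr expR0.
set E := expR (- c) in E0 E1 EC.
(* This is the lower bound of [w] at distance [delta] from [x0]; farther away the base
   [1 + eta - w y] is at most [1]. *)
pose eta := E ^+ 2 * delta ^+ 2 / 4.
have eta0 : 0 < eta by rewrite divr_gt0// mulr_gt0// exprn_gt0.
(* Within distance [d] of [x0], [w] is at most [d ^+ 2 / 4 = eta / 4], so the base is at least
   [1 + eta / 2]. *)
pose d := E * delta / 2.
have dp : 0 < d by rewrite divr_gt0// mulr_gt0.
have dd : d <= delta by rewrite /d; nra.
set J := \int[mu]_(y in @I11 R) `|f y|.
(* By Bernoulli's inequality the peak contributes at least [N * (eta / 2) * m] over a length
   [2 * d]; [N] makes this exceed [J], the most that can be lost elsewhere. *)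
have [N [Np JN]] : exists N : nat, (0 < N)%N /\ J < N%:R * (eta * m * d).
  exists (Num.truncn (J / (eta * m * d))).+1; split => //.
  by rewrite -ltr_pdivrMr ?truncnS_gt// !mulr_gt0.
have N0 : 0 < N%:R :> R by rewrite ltr0n.
pose t := c / (2 * N)%:R.
have t0 : 0 < t by rewrite divr_gt0// ltr0n muln_gt0.
have tc : t <= c / 2.
  have N1 : 1 <= N%:R :> R by rewrite ler1n.
  by rewrite /t natrM ler_pdivrMr ?mulr_gt0// mulrA divfK// ler_peMr// ltW.
pose a0 := expR (t * x0).
pose w y := E / 4 / t ^+ 2 * (expR (t * y) - a0) ^+ 2.
pose p := ((1 + eta)%:P - (E / 4 / t ^+ 2) *: ('X - a0%:P) ^+ 2) ^+ N.
have pE y : p.[expR (t * y)] = (1 + eta - w y) ^+ N by rewrite /p /w !hornerE.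
have sp : (size p <= (2 * N).+1)%N.
  rewrite (leq_trans (size_poly_exp_leq _ _))// ltnS leq_mul2r; apply/orP; right.
  rewrite -subn1 leq_subLR (leq_trans (size_polyD _ _))// geq_max.
  rewrite (leq_trans (size_polyC_leq1 _))//= size_polyN.
  by rewrite (leq_trans (size_scale_leq _ _))// size_exp_XsubC.
have N2 : (0 < 2 * N)%N by rewrite muln_gt0.
have [iQ Q0] := Rintegral_poly_expR c f p (2 * N)%N sp N2 intf lap0.
(* Exponents stay within [c / 2], so squaring the two-sided bounds gives factors [E] and [expR c],
   and the prefactor [E] in [w] cancels the latter. The division by [4] gives [w <= 1] on [[-1, 1]],
   which keeps the base nonnegative. *)
have wb y : -1 <= y <= 1 -> E ^+ 2 / 4 * `|y - x0| ^+ 2 <= w y <= `|y - x0| ^+ 2 / 4.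
  move=> y1.
  have bd z : -1 <= z <= 1 -> `|t * z| <= c / 2.
    move=> z1; rewrite normrM (gtr0_norm t0) (le_trans _ tc)// ler_piMr ?(ltW t0)//.
    by rewrite ler_norml.
  have x01 : -1 <= x0 <= 1 by apply/andP; split; lra.
  have /andP[h1 h2] := norm_expRB_bounds _ _ _ (bd y y1) (bd x0 x01).
  have e2 : expR (c / 2) ^+ 2 = expR c by rewrite -expRM_natl; congr expR; field.
  have e2N : expR (- (c / 2)) ^+ 2 = E by rewrite -expRM_natl /E; congr expR; field.
  have wE : w y = E / 4 / t ^+ 2 * `|expR (t * y) - a0| ^+ 2.
    by rewrite /w real_normK ?num_real.
  have tt : t != 0 by rewrite gt_eqF.
  have k0 : 0 <= E / 4 / t ^+ 2 by rewrite !divr_ge0 ?sqr_ge0 ?ltW.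
  rewrite -mulrBr normrM (gtr0_norm t0) in h1 h2.
  rewrite wE; apply/andP; split.
    have -> : E ^+ 2 / 4 * `|y - x0| ^+ 2 =
        E / 4 / t ^+ 2 * (expR (- (c / 2)) * (t * `|y - x0|)) ^+ 2.
      rewrite (_ : (_ * (t * _)) ^+ 2 = E * (t * `|y - x0|) ^+ 2); first by field.
      by rewrite (exprMn 2) e2N.
    rewrite ler_wpM2l// ler_pXn2r// nnegrE//.
    by rewrite mulr_ge0 ?expR_ge0// mulr_ge0 ?(ltW t0).
  have -> : `|y - x0| ^+ 2 / 4 =
      E / 4 / t ^+ 2 * (expR (c / 2) * (t * `|y - x0|)) ^+ 2.
    rewrite (_ : (_ * (t * _)) ^+ 2 = expR c * (t * `|y - x0|) ^+ 2); last by rewrite (exprMn 2) e2.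
    have -> : E / 4 / t ^+ 2 * (expR c * (t * `|y - x0|) ^+ 2) =
       (expR c * E) * (`|y - x0| ^+ 2 / 4) by field.
    by rewrite EC mul1r.
  by rewrite ler_wpM2l// ler_pXn2r// nnegrE// mulr_ge0 ?expR_ge0// mulr_ge0 ?(ltW t0).
pose A := `[x0 - d, x0 + d]%classic : set R.
have mA : measurable A by exact: measurable_itv.
have AI : A `<=` @I11 R.
  by move=> y; rewrite /A /I11/= !in_itv/= => /andP[? ?]; apply/andP; split; lra.
have muA : (\int[mu]_(y in @I11 R) (\1_A y)%:E = (2 * d)%:E)%E.
  rewrite integral_indic//; last exact: measurable_I11.
  rewrite (setIidl AI); have := @lebesgue_measure_itv R `[x0 - d, x0 + d].
  rewrite /= lte_fin ifT; last lra.
  by move=> h; refine (eq_trans h _); rewrite -EFinB; congr EFin; ring.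
have iA : integrable11 (\1_A : R -> R).
  apply: integrable_of_fin_num; first exact: measurable_I11.
    by apply/measurable_EFinP; exact: measurable_indic.
  by rewrite muA.
have iN : integrable11 (fun y => `|f y|) by exact: integrable_norm.
(* A minorant of the integrand in all three zones: the peak, the ring between [d] and [delta] where
   the integrand is nonnegative, and the outside where the power lies in [[0, 1]]. *)
pose h y := N%:R * (eta / 2) * m * \1_A y - `|f y|.
have ih : integrable11 h.
  by apply: integrable11B => //; exact: integrable11Z.
have : \int[mu]_(y in @I11 R) h y <= \int[mu]_(y in @I11 R) (p.[expR (t * y)] * f y).
  apply: (le_Rintegral _ ih iQ); first exact: measurable_I11.
  move=> y; rewrite /I11/= in_itv/= => y1.
  rewrite pE /h; have /andP[w1 w2] := wb y y1.
  have n0 := normr_ge0 (f y).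
  have b0 : 0 <= 1 + eta - w y.
    have : `|y - x0| <= 2 by rewrite ler_norml; apply/andP; split; lra.
    have := normr_ge0 (y - x0); nra.
  have q0 : 0 <= (1 + eta - w y) ^+ N by rewrite exprn_ge0.
  have [yd|yd] := leP `|y - x0| d.
    have yA : y \in A.
      by rewrite /A inE/= in_itv/= -ler_distl.
    rewrite indicE yA mulr1; apply: (@le_trans _ _ (N%:R * (eta / 2) * m)).
      by rewrite gerBl.
    apply: ler_pM; rewrite ?(ltW m0)//.
    - by rewrite mulr_ge0 ?ltW// divr_gt0.
    - apply: (@le_trans _ _ ((1 + eta / 2) ^+ N)).
        by rewrite (le_trans _ (bernoulli_expr _ _ _)) ?lerDr// divr_ge0 ?ltW.
      have : w y <= eta / 2.
        rewrite (le_trans w2)// /eta.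
        have : `|y - x0| ^+ 2 <= d ^+ 2 by rewrite ler_pXn2r// nnegrE// ltW.
        rewrite /d; nra.
      by move=> ?; rewrite lerXn2r ?nnegrE//; [rewrite addr_ge0// divr_ge0 ?ltW|lra].
    - by apply: fm; lra.
  have yA : y \in A = false.
    by apply/negbTE; rewrite /A notin_setE/= in_itv/= -ler_distl; apply/negP; rewrite -ltNge.
  rewrite indicE yA mulr0 sub0r.
  have [yd'|yd'] := leP `|y - x0| delta.
    rewrite (@le_trans _ _ 0) ?oppr_le0// mulr_ge0//.
    by rewrite (le_trans (ltW m0))// fm.
  have b1 : 1 + eta - w y <= 1.
    have : delta ^+ 2 <= `|y - x0| ^+ 2 by rewrite ler_pXn2r// ?nnegrE// ltW.
    by rewrite /eta; nra.
  rewrite lerNl (le_trans (ler_norm _))// normrN normrM ler_piMl// ger0_norm//.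
  exact: exprn_ile1.
have iZ : integrable11 (fun y => N%:R * (eta / 2) * m * \1_A y) by exact: integrable11Z.
rewrite Q0 RintegralB; [|exact: measurable_I11|exact: iZ|exact: iN].
rewrite RintegralZl -/J; [|exact: measurable_I11|exact: iA].
have -> : \int[mu]_(y in @I11 R) \1_A y = 2 * d.
  by rewrite /Rintegral muA.
have : N%:R * (eta * m * d) = N%:R * (eta / 2) * m * (2 * d) by field.
by lra.
Qed.

Lemma laplace_Lop c alpha (phi : R -> R) x :
  laplace c (fun y => phi y * omega alpha y) x = fine (Lop c alpha phi x).
Proof. by rewrite /laplace /Rintegral /Lop; under eq_integral do rewrite mulrA. Qed.

Lemma integrable_of_Lop c alpha (phi : R -> R) (r : R) : measurable_fun (@I11 R) phi ->
  Lop c alpha phi 0 = r%:E -> integrable11 (fun y => phi y * omega alpha y).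
Proof.
move=> mphi L0; apply: integrable_of_fin_num; first exact: measurable_I11.
  apply/measurable_EFinP; apply: measurable_funM => //; exact: measurable_omega.
rewrite (_ : (\int[mu]_(y in _) _)%E = Lop c alpha phi 0); first by rewrite L0.
by apply: eq_integral => y _; rewrite /= mulr0 mul0r expR0 mul1r.
Qed.

(** For [lam != 0], [phi] is its transform divided by [lam] and inherits its Lipschitz bound. For
    [lam = 0] the transform vanishes, and injectivity, tested where [phi] is continuous, contradicts
    the normalization. *)
Lemma pswf_lipschitz c alpha n (phi : R -> R) : 0 < c -> is_pswf c alpha n phi ->
  (forall x, -1 < x < 1 -> {for x, continuous phi}) ->
  exists2 L : R, 0 <= L & lipschitz11 L phi.
Proof.
move=> c0 [[mphi _] [nrm [lam [_ eqn]]]] cphi.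
pose f y := phi y * omega alpha y.
have intf : integrable11 f.
  apply: (integrable_of_Lop c _ _ _ mphi (eqn 0 _)).
  by rewrite lerN10 ler01.
have lapE x : -1 <= x <= 1 -> laplace c f x = lam * phi x.
  by move=> x1; rewrite laplace_Lop eqn.
have lam0 : lam != 0.
  apply/eqP => lam0.
  have phi0 x : -1 < x < 1 -> phi x = 0.
    move=> x1; apply/eqP; apply: contraT => px.
    (* The factor [phi x] makes the function positive at [x] whatever the sign of [phi x]. *)
    pose g y := phi x * f y.
    have ig : integrable11 g by exact: integrable11Z.
    have lapg y : 0 <= y <= 1 -> laplace c g y = 0.
      move=> /andP[y0 y1]; rewrite /laplace /g.
      under eq_Rintegral do rewrite mulrCA.
      rewrite RintegralZl; [|exact: measurable_I11|exact: integrable_expR_mul].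
      rewrite -/(laplace c f y) lapE ?lam0 ?mul0r ?mulr0//.
      by apply/andP; split; lra.
    have cg : {for x, continuous g}.
      apply: continuousM; first exact: cvg_cst.
      apply: continuousM; first exact: cphi.
      exact: is_derive_continuous (is_derive_omega alpha x x1).
    have gx : 0 < g x.
      rewrite /g /f mulrA -expr2 mulr_gt0 ?omega_gt0//.
      by rewrite lt_neqAle sqr_ge0 andbT eq_sym sqrf_eq0.
    have g2 : 0 < g x / 2 by rewrite divr_gt0.
    have : \forall y \near x, `|g x - g y| < g x / 2.
      by move/cvgrPdist_lt : cg; apply.
    move=> /nbhs_ballP[e /= e0 He].
    case/andP: x1 => x1 x2.
    pose dl := Num.min (e / 2) (Num.min (1 - x) (x + 1)).
    have dl0 : 0 < dl by rewrite !lt_min; apply/and3P; split; lra.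
    have [dl1 dl2 dl3] : [/\ dl <= e / 2, dl <= 1 - x & dl <= x + 1].
      by rewrite !ge_min !lexx ?orbT.
    have b1 : -1 <= x - dl by lra.
    have b2 : x + dl <= 1 by lra.
    exfalso; apply: (laplace_eq0_bump c g x dl (g x / 2) c0 ig lapg dl0 b1 b2 g2).
    move=> y yx; have /He : ball x e y by rewrite /ball/= distrC; lra.
    by rewrite ltr_norml => /andP[? ?]; lra.
  have : (\int[mu]_(y in @I11 R) (phi y ^+ 2 * omega alpha y)%:E = 0)%E.
    (* Vanishing is known on the open interval only; the endpoints have measure zero. *)
    rewrite /I11 integral_itv_bndoo; last first.
      apply/measurable_EFinP; apply: measurable_funM; last exact: measurable_omega.
      apply: measurable_funX; apply: measurable_funS mphi; first exact: measurable_I11.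
      by move=> y; rewrite /I11/= !in_itv/= => /andP[? ?]; rewrite !ltW.
    apply: integral0_eq => y; rewrite /= in_itv/= => y1.
    by rewrite phi0// expr0n mul0r.
  by rewrite nrm => /eqP; rewrite gt_eqF// lte_fin.
have l := laplace_lipschitz c f (ltW c0) intf.
set L := (X in lipschitz11 X _) in l.
have L0 : 0 <= L.
  by rewrite !mulr_ge0 ?expR_ge0 ?(ltW c0)// Rintegral_ge0.
exists (L / `|lam|); first by rewrite divr_ge0.
move=> x y x1 y1; have := l x y x1 y1.
by rewrite !lapE// -mulrBr normrM mulrC => h; rewrite mulrAC ler_pdivlMr ?normr_gt0.
Qed.

End Injectivity.

(** * From the weighted mass near the endpoints to the bound on [f 1] *)

Section Bound.
Context {R : realType}.
Notation mu := (@lebesgue_measure R).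
Implicit Types (c alpha chi x y L M m : R) (f g phi : R -> R).

(** Since [|t| <= 1], the mass dominates the integral of [m ^+ 2 * |t| * omega alpha t], which has
    an explicit primitive. The two sides are cut at [b < 1], then [b] tends to [1]. *)
Lemma weighted_mass_le alpha m x0 phi : - 1 < alpha -> 0 <= m -> 0 < x0 < 1 ->
  measurable_fun (@I11 R) phi ->
  (\int[mu]_(y in @I11 R) (phi y ^+ 2 * omega alpha y)%:E = 1)%E ->
  (forall t, x0 <= `|t| < 1 -> m <= `|phi t|) ->
  m ^+ 2 / (alpha + 1) * omega (alpha + 1) x0 <= 1.
Proof.
move=> a1 m0 /andP[x00 x01] mphi nrm mle.
have a10 : 0 < alpha + 1 by lra.
rewrite -subr_le0.
apply: (@le0_of_le_scale_omega R _ (m ^+ 2 / (alpha + 1)) (alpha + 1) x0) => //.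
  by rewrite x01 ltW.
move=> b /andP[]; rewrite le_eqVlt => /predU1P[<- _|x0b b1]; first lra.
have bN : omega (alpha + 1) (- b) = omega (alpha + 1) b by rewrite /omega sqrrN.
have x0N : omega (alpha + 1) (- x0) = omega (alpha + 1) x0 by rewrite /omega sqrrN.
pose F y : \bar R := (phi y ^+ 2 * omega alpha y)%:E.
have F0 y : (0 <= F y)%E by rewrite lee_fin mulr_ge0 ?sqr_ge0 ?omega_ge0.
have mF (D : set R) : D `<=` @I11 R -> measurable_fun D F.
  move=> DI; apply/measurable_EFinP; apply: measurable_funM; last exact: measurable_omega.
  by apply: measurable_funX; apply: measurable_funS mphi; first exact: measurable_I11.
(* The sign [s] turns [|t|] into [s * t], so one argument serves both sides. *)
have half (s u v : R) : (s == 1) || (s == -1) -> -1 < u -> u < v -> v < 1 ->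
    (forall t, u <= t <= v -> x0 <= s * t <= b) ->
    ((m ^+ 2 * s / (2 * (alpha + 1)) * (omega (alpha + 1) u - omega (alpha + 1) v))%:E
      <= \int[mu]_(y in `[u, v]) F y)%E.
  move=> s1 u1 uv v1 H.
  have ns : `|s| = 1 by case/orP: s1 => /eqP ->; rewrite ?normrN1 ?normr1.
  have nst t : u <= t <= v -> `|t| = s * t.
    move=> /H /andP[h _]; rewrite -(ger0_norm (le_trans (ltW x00) h)).
    by rewrite normrM ns mul1r.
  rewrite -(integral_scale_id_omega _ (m ^+ 2 * s))//.
  apply: ge0_le_integral.
  - exact: measurable_itv.
  - move=> t; rewrite /= in_itv/= => t1; rewrite lee_fin mulr_ge0 ?omega_ge0//.
    have /andP[h _] := H t t1.
    by rewrite -mulrA mulr_ge0 ?sqr_ge0// (le_trans (ltW x00)).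
  - apply/measurable_EFinP; apply: measurable_funM; last exact: measurable_omega.
    exact: measurable_funTS (mulrl_measurable _).
  - apply: mF => t; rewrite /I11/= !in_itv/= => /andP[? ?]; apply/andP; split; lra.
  - move=> t; rewrite /= in_itv/= => t1; rewrite lee_fin ler_wpM2r ?omega_ge0//.
    have /andP[h1 h2] := H t t1.
    have hm : m <= `|phi t|.
      by apply: mle; rewrite nst// h1/= (le_lt_trans h2).
    apply: (@le_trans _ _ (m ^+ 2)); first by rewrite -mulrA ler_piMr ?sqr_ge0//; lra.
    by rewrite -(@real_normK _ (phi t)) ?num_real// ler_pXn2r// nnegrE.
have hA : (((m ^+ 2 / (2 * (alpha + 1)) * (omega (alpha + 1) x0 - omega (alpha + 1) b))%:E
      <= \int[mu]_(y in `[x0, b]) F y)%E).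
  have := half 1 x0 b; rewrite mulr1 eqxx; apply => //; first lra.
  by move=> t; rewrite mul1r.
have hB : (((m ^+ 2 / (2 * (alpha + 1)) * (omega (alpha + 1) x0 - omega (alpha + 1) b))%:E
      <= \int[mu]_(y in `[(- b)%R, (- x0)%R]) F y)%E).
  have := half (-1) (- b) (- x0); rewrite eqxx orbT bN x0N.
  rewrite (_ : m ^+ 2 * -1 / _ * _ =
    m ^+ 2 / (2 * (alpha + 1)) * (omega (alpha + 1) x0 - omega (alpha + 1) b)); last first.
    by field; rewrite gt_eqF.
  by apply => //; [lra|lra|lra|move=> t /andP[? ?]; apply/andP; split; lra].
have := @ge0_subset_integral _ _ R mu (`[x0, b] `|` `[- b, - x0])%classic (@I11 R) _ _ F.
rewrite nrm ge0_integral_setU; last first.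
- apply/disj_setPS => t [] /=; rewrite !in_itv/= => /andP[? ?] /andP[? ?]; lra.
- by [].
- apply: mF => t [] /=; rewrite /I11/= !in_itv/= => /andP[? ?]; apply/andP; split; lra.
- exact: measurable_itv.
- exact: measurable_itv.
move=> /(_ _ _ _ _ _)/(le_trans (leeD hA hB)) h.
have : m ^+ 2 / (2 * (alpha + 1)) * (omega (alpha + 1) x0 - omega (alpha + 1) b) +
    m ^+ 2 / (2 * (alpha + 1)) * (omega (alpha + 1) x0 - omega (alpha + 1) b) <= 1.
  rewrite -lee_fin EFinD; apply: h.
  - by apply: measurableU; exact: measurable_itv.
  - exact: measurable_I11.
  - exact: mF.
  - by [].
  - by move=> t [] /=; rewrite /I11/= !in_itv/= => /andP[? ?]; apply/andP; split; lra.
have -> : m ^+ 2 / (2 * (alpha + 1)) * (omega (alpha + 1) x0 - omega (alpha + 1) b) +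
    m ^+ 2 / (2 * (alpha + 1)) * (omega (alpha + 1) x0 - omega (alpha + 1) b) =
    m ^+ 2 / (alpha + 1) * omega (alpha + 1) x0 - m ^+ 2 / (alpha + 1) * omega (alpha + 1) b.
  by field; rewrite gt_eqF.
by lra.
Qed.

(** [kappa] is the fraction of [|f 1|] that survives down to [x0], and by reflection also on the
    left, where [|f (-1)| = |f 1|]. *)
Lemma endpoint_value_le c alpha chi L f g x0 kappa :
  - (1 / 2) < alpha -> 0 < chi -> c ^+ 2 <= (1 / 2 + alpha) * chi ->
  0 <= L -> lipschitz11 L f -> ode_solution c alpha chi f g ->
  measurable_fun (@I11 R) f ->
  (\int[mu]_(y in @I11 R) (f y ^+ 2 * omega alpha y)%:E = 1)%E ->
  0 < x0 < 1 -> 0 <= kappa ->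
  (chi + c ^+ 2) / (2 * (alpha + 1) * x0) * (1 - x0) <= 1 - kappa ->
  kappa ^+ 2 * `|f 1| ^+ 2 * omega (alpha + 1) x0 <= alpha + 1.
Proof.
move=> a1 chi0 cq L0 fL sol mf nrm /andP[x00 x01] k0 ak.
have a10 : 0 < alpha + 1 by lra.
have fM t : -1 <= t <= 1 -> `|f t| <= `|f 1|.
  exact: (ode_solution_le_endpoint c alpha chi a1 chi0 cq L f g).
have par := ode_solution_parity c alpha chi a1 chi0 cq L f g L0 fL sol.
have aM1 : - 1 < alpha by lra.
have lower h k t : lipschitz11 L h -> ode_solution c alpha chi h k ->
    (forall t, -1 <= t <= 1 -> `|h t| <= `|f 1|) -> `|h 1| = `|f 1| ->
    x0 <= t < 1 -> kappa * `|f 1| <= `|h t|.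
  move=> hL hs hM h1 t1.
  have := ode_solution_ge_near_endpoint c alpha chi L `|f 1| h k x0 t aM1 chi0 L0 hL hs hM x00 t1.
  apply: le_trans; rewrite h1.
  have -> : `|f 1| - (chi + c ^+ 2) * `|f 1| / (2 * (alpha + 1) * x0) * (1 - x0) =
    (1 - (chi + c ^+ 2) / (2 * (alpha + 1) * x0) * (1 - x0)) * `|f 1|.
    by field; rewrite !gt_eqF.
  by rewrite ler_wpM2r//; lra.
have mle t : x0 <= `|t| < 1 -> kappa * `|f 1| <= `|f t|.
  have [t0|t0] := leP 0 t.
    by rewrite (ger0_norm t0) => t1; apply: (lower f g).
  rewrite (ltr0_norm t0) => t1; rewrite -[t]opprK.
  apply: (lower (fun t => f (- t)) (fun t => - g (- t))) => //.
  - exact: lipschitz11_reflect.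
  - exact: ode_solution_reflect.
  - by move=> s s1; apply: fM; apply/andP; split; lra.
have x011 : 0 < x0 < 1 by rewrite x00.
have := weighted_mass_le alpha (kappa * `|f 1|) x0 f aM1 (mulr_ge0 k0 (normr_ge0 _)) x011 mf nrm mle.
by rewrite mulrAC ler_pdivrMr// mul1r exprMn.
Qed.

Lemma le_sqrt_powR_of_sqr_le alpha chi M : 0 < alpha + 1 -> 0 < chi -> 0 <= M ->
  M ^+ 2 <= 9 * (alpha + 1) * chi `^ (alpha + 1) ->
  M <= 3 * Num.sqrt (alpha + 1) * chi `^ ((alpha + 1) / 2).
Proof.
move=> a0 chi0 M0 h.
have r0 : 0 <= 3 * Num.sqrt (alpha + 1) * chi `^ ((alpha + 1) / 2).
  by rewrite mulr_ge0 ?powR_ge0// mulr_ge0 ?sqrtr_ge0.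
rewrite -(@ler_pXn2r _ 2%N)// ?nnegrE//; apply: (le_trans h).
rewrite !exprMn sqr_sqrtr ?(ltW a0)// -(powR_mulrn 2 (powR_ge0 _ _)) -powRrM divfK//.
by rewrite (_ : 3 ^+ 2 = 9 :> R)//; ring.
Qed.

End Bound.

Theorem theorem2 (R : realType) (c alpha : R) (n : nat) (phi : R -> R) (chi : R) :
  0 < c -> - (1 / 2) < alpha ->
  is_pswf c alpha n phi ->
  is_SL_eigenvalue c alpha phi chi ->
  6 * ((alpha + 1) / (alpha + 3)) <= chi ->
  (alpha <= 0 -> c ^+ 2 / chi <= 1 / 2 + alpha) ->
  (0 < alpha -> c ^+ 2 / chi <= Num.min 1 (1 / 2 + alpha)) ->
  sup [set `|phi t| | t in `[-1, 1]] = `|phi 1| /\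
  `|phi 1| <= 3 * Num.sqrt (alpha + 1) * powR chi ((alpha + 1) / 2).
Proof.
move=> c0 a1 pswf SL chiB q1 q2.
have a10 : 0 < alpha + 1 by lra.
have a30 : 0 < alpha + 3 by lra.
have {}chiB : 6 * (alpha + 1) <= chi * (alpha + 3) by rewrite -ler_pdivrMr// -mulrA.
have chi0 : 0 < chi by nra.
have cq : c ^+ 2 <= (1 / 2 + alpha) * chi.
  rewrite -ler_pdivrMr//; have [/q1//|/q2] := leP alpha 0.
  by rewrite le_min => /andP[].
have sol := SL_ode_solution _ _ _ _ SL.
have [|L L0 phiL] := pswf_lipschitz c alpha n phi c0 pswf.
  by move=> x /sol[phi' _]; exact: is_derive_continuous phi'.
have phiM t : -1 <= t <= 1 -> `|phi t| <= `|phi 1|.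
  exact: (ode_solution_le_endpoint c alpha chi a1 chi0 cq L phi (derive1 phi)).
have o11 : -1 <= (1 : R) <= 1 by apply/andP; split; lra.
split.
  have ub : ubound [set `|phi t| | t in `[-1, 1]] `|phi 1|.
    by move=> _ [t + <-]; rewrite /= in_itv/=; exact: phiM.
  have in1 : [set `|phi t| | t in `[-1, 1]] `|phi 1| by exists 1 => //=; rewrite in_itv.
  apply/eqP; rewrite eq_le; apply/andP; split.
    by apply: ge_sup => //; exists `|phi 1|.
  by apply: ub_le_sup => //; exists `|phi 1|.
have [[mphi _] [nrm _]] := pswf.
(* The cut [x0] satisfies [1 - x0 ^+ 2 = (theta * chi)^-1], so its weight is an explicit power of
   [theta * chi]; the condition with [9] then produces the constant [3]. *)
have bound (theta kappa : R) : 0 < theta -> 1 < theta * chi ->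
    0 <= kappa -> 1 <= 9 * kappa ^+ 2 * theta `^ (- (alpha + 1)) ->
    (forall x0, 0 < x0 < 1 -> x0 ^+ 2 = 1 - (theta * chi)^-1 ->
      (chi + c ^+ 2) / (2 * (alpha + 1) * x0) * (1 - x0) <= 1 - kappa) ->
    `|phi 1| <= 3 * Num.sqrt (alpha + 1) * chi `^ ((alpha + 1) / 2).
  move=> th0 tchi k0 k9 H.
  apply: le_sqrt_powR_of_sqr_le => //.
  have tc0 : 0 < theta * chi by rewrite mulr_gt0.
  have i0 : 0 < (theta * chi)^-1 by rewrite invr_gt0.
  have i1 : (theta * chi)^-1 < 1 by rewrite invf_lt1.
  pose x0 := Num.sqrt (1 - (theta * chi)^-1).
  have x02 : x0 ^+ 2 = 1 - (theta * chi)^-1 by rewrite sqr_sqrtr//; lra.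
  have x00 : 0 < x0 by rewrite sqrtr_gt0; lra.
  have x01 : 0 < x0 < 1 by rewrite x00/=; nra.
  have := endpoint_value_le c alpha chi L phi (derive1 phi) x0 kappa a1 chi0 cq L0 phiL
    sol mphi nrm x01 k0 (H x0 x01 x02).
  rewrite /omega x02 subKr -powR_inv1 ?(ltW tc0)// -powRrM mulN1r powRM ?(ltW th0) ?(ltW chi0)// => h.
  have p0 : 0 < chi `^ (alpha + 1) by rewrite powR_gt0.
  have cp : chi `^ (- (alpha + 1)) * chi `^ (alpha + 1) = 1.
    by rewrite powRN mulVf// gt_eqF.
  set T := theta `^ _ in h k9; set M := `|phi 1| ^+ 2 in h *.
  have M0 : 0 <= M by rewrite sqr_ge0.
  have : kappa ^+ 2 * M * T <= (alpha + 1) * chi `^ (alpha + 1).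
    have -> : kappa ^+ 2 * M * T =
        kappa ^+ 2 * M * (T * chi `^ (- (alpha + 1))) * chi `^ (alpha + 1).
      by rewrite -[RHS]mulrA -(mulrA T) cp mulr1.
    by rewrite ler_pM2r.
  have : M <= 9 * kappa ^+ 2 * T * M by rewrite ler_peMl.
  lra.
have [a0|a0] := leP alpha 0.
  (* Here [chi] is only known to be at least [6 / 5], and [theta = 2] keeps [x0] above [3 / 4]. The
     constants fit because [9 * (3 / 5) ^+ 2 / 2 = 81 / 50]. *)
  apply: (bound 2 (3 / 5)) => //.
  - nra.
  - have h2 : (2 : R) `^ (alpha + 1) <= 2.
      rewrite -[leRHS]powRr1// ler_powR//; lra.
    have p0 : 0 < (2 : R) `^ (alpha + 1) by rewrite powR_gt0.
    by rewrite powRN ler_pdivlMr// mul1r; lra.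
  - move=> x0 /andP[x00 x01] x02.
    have chi65 : 6 / 5 <= chi by nra.
    have e2 : chi * (1 - x0 ^+ 2) = 1 / 2 by rewrite x02; field; rewrite gt_eqF.
    have e : chi * (1 - x0) * (1 + x0) = 1 / 2 by rewrite -[RHS]e2; ring.
    have x0sq : 9 / 16 <= x0 ^+ 2 by move: e2; set z := x0 ^+ 2 => e2; nra.
    have x034 : 3 / 4 <= x0 by clear -x00 x0sq; nra.
    have -> : (chi + c ^+ 2) / (2 * (alpha + 1) * x0) * (1 - x0) =
        (chi + c ^+ 2) * (1 - x0) / (2 * (alpha + 1) * x0) by field; rewrite !gt_eqF.
    rewrite ler_pdivrMr ?mulr_gt0//.
    (* From [cq], [chi + c ^+ 2 <= (3 / 2 + alpha) * chi], and [3 / 2 + alpha <= 2 * (alpha + 1)]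
       since [alpha > - 1 / 2]. *)
    have : (chi + c ^+ 2) * (1 - x0) <= 2 * (alpha + 1) * (chi * (1 - x0)).
      rewrite mulrA ler_wpM2r//; nra.
    have : chi * (1 - x0) <= 2 / 5 * x0.
      move: e; set u := chi * (1 - x0) => e; clear -e x034; nra.
    nra.
(* For [alpha > 0] the hypothesis gives [chi >= 2], so [theta = 1] suffices, and
   [9 * (1 / 3) ^+ 2 = 1] exactly. *)
apply: (bound 1 (1 / 3)) => //.
- rewrite mul1r; nra.
- by rewrite powR1; lra.
- move=> x0 /andP[x00 x01] x02.
  have chi2 : 2 <= chi by nra.
  have e2 : chi * (1 - x0 ^+ 2) = 1 by rewrite x02; field; rewrite gt_eqF.
  have e : chi * (1 - x0) * (1 + x0) = 1 by rewrite -[RHS]e2; ring.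
  have x0sq : 1 / 2 <= x0 ^+ 2 by move: e2; set z := x0 ^+ 2 => e2; nra.
  have x034 : 7 / 10 <= x0 by clear -x00 x0sq; nra.
  have -> : (chi + c ^+ 2) / (2 * (alpha + 1) * x0) * (1 - x0) =
      (chi + c ^+ 2) * (1 - x0) / (2 * (alpha + 1) * x0) by field; rewrite !gt_eqF.
  rewrite ler_pdivrMr ?mulr_gt0//.
  (* Now [alpha > 0] gives the sharper [3 / 2 + alpha <= 3 / 2 * (alpha + 1)]. *)
  have : (chi + c ^+ 2) * (1 - x0) <= 3 / 2 * (alpha + 1) * (chi * (1 - x0)).
    rewrite mulrA ler_wpM2r//; nra.
  have : 3 / 4 * (chi * (1 - x0)) <= 2 / 3 * x0.
    move: e; set u := chi * (1 - x0) => e; clear -e x034; nra.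
  nra.
Qed.
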